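(* If $T$ is a tree and $H$ is a graph, then $\gamma_{gr}^{t}(T\times H)=\gamma_{gr}^{t}(T)\,\gamma_{gr}^{t}(H)$.
   Context: Graphs are finite, simple and undirected. $N(v)$ denotes the open neighborhood of $v$. A sequence $(v_1,\ldots,v_k)$ of distinct vertices of $G$ is a (legal) open neighborhood sequence if $N(v_i)\setminus\bigcup_{j=1}^{i-1}N(v_j)\neq\emptyset$ for each $i\in\{1,\ldots,k\}$. The Grundy total domination number $\gamma_{gr}^{t}(G)$ is the maximum length of a legal open neighborhood sequence of $G$ (it is $0$ if $G$ has no edges). The direct product $G\times H$ has vertex set $V(G)\times V(H)$, and $(g_1,h_1)$, $(g_2,h_2)$ are adjacent iff $g_1g_2\in E(G)$ and $h_1h_2\in E(H)$. *)

(* Defs.v *)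
From mathcomp Require Import all_boot.

Set Implicit Arguments.
Unset Strict Implicit.
Unset Printing Implicit Defensive.

Record sgraph := SGraph {
  vertex :> finType;
  adj : rel vertex;
  adj_sym : symmetric adj;
  adj_irr : irreflexive adj
}.

Definition nbhd (G : sgraph) (v : G) : {set G} := [set u | adj v u].

Definition open_nbhd_seq (G : sgraph) (k : nat) (s : k.-tuple G) : bool :=
  uniq s &&
  [forall i : 'I_k,
     nbhd (tnth s i) :\: \bigcup_(j < k | j < i) nbhd (tnth s j) != set0].

(* Legal sequences have distinct entries, so their lengths are at most #|G|
   and the bound on k loses none of them; the empty sequence is legal. *)
Definition grundy_total (G : sgraph) : nat :=
  \max_(k < #|G|.+1 | [exists s : k.-tuple G, open_nbhd_seq s]) k.

Lemma leq_grundy_total (G : sgraph) (k : nat) (s : k.-tuple G) :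
  open_nbhd_seq s -> k <= grundy_total G.
Proof.
move=> hs; have /andP[us _] := hs.
have lt_k : k < #|G|.+1 by rewrite ltnS -(size_tuple s) -(card_uniqP us) max_card.
by apply: (bigmax_sup (Ordinal lt_k)) => //; apply/existsP; exists s.
Qed.

Lemma grundy_total_attained (G : sgraph) :
  exists s : (grundy_total G).-tuple G, open_nbhd_seq s.
Proof.
have h0 : [exists s : 0.-tuple G, open_nbhd_seq s].
  by apply/existsP; exists [tuple]; apply/andP; split=> //; apply/forallP; case.
rewrite /grundy_total (bigop.bigmax_eq_arg (@ord0 #|G|)) //.
by case: arg_maxnP => // k /existsP.
Qed.

Section DirectProduct.

Variables G H : sgraph.

Definition direct_adj (x y : G * H) : bool := adj x.1 y.1 && adj x.2 y.2.

Lemma direct_adj_sym : symmetric direct_adj.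
Proof. by move=> x y; rewrite /direct_adj adj_sym [adj x.2 _]adj_sym. Qed.

Lemma direct_adj_irr : irreflexive direct_adj.
Proof. by move=> x; rewrite /direct_adj adj_irr. Qed.

Definition direct_product : sgraph := SGraph direct_adj_sym direct_adj_irr.

End DirectProduct.

Definition connected_graph (G : sgraph) : Prop :=
  0 < #|G| /\ forall x y : G, connect (@adj G) x y.

(* ucycle also holds of [::] and of [:: x; y] for an edge xy, which are not
   cycles of a simple graph. *)
Definition acyclic_graph (G : sgraph) : Prop :=
  forall c : seq G, 2 < size c -> ~ ucycle (@adj G) c.

Definition is_tree (G : sgraph) : Prop := connected_graph G /\ acyclic_graph G.

(* Main.v *)
Require Import Defs.
From mathcomp Require Import all_boot.

(** Record a legal sequence together with footprints, as a list of adjacent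
    pairs (x, y) in which y is not adjacent to any earlier x.  Lexicographic
    products of such lists give [grundy (G x H) >= grundy G * grundy H] for all
    graphs.  Conversely, let C be a vertex cover of G.  In a legal sequence of
    G x H, the entries whose vertex has G-coordinate a given c project to a
    legal sequence of H, and so do those whose footprint has G-coordinate c;
    every entry is of one of these kinds for some c in C, hence
    [grundy (G x H) <= 2 |C| grundy H].  A forest has a vertex cover C with
    [2 |C| <= grundy T]: if v is a leaf with neighbor u, delete the edges at u,
    add u to the cover, and extend the sequence by v in front and u at the
    end. *)

Set Implicit Arguments.
Unset Strict Implicit.
Unset Printing Implicit Defensive.

Definition footprinted (V : Type) (e : rel V) (s : seq (V * V)) : bool :=
  all (fun p => e p.1 p.2) s && pairwise (fun p q => ~~ e p.1 q.2) s.

Lemma footprinted_leq_grundy (G : sgraph) (s : seq (G * G)) :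
  footprinted (@adj G) s -> size s <= grundy_total G.
Proof.
move=> /andP[/allP es ps].
(* A repeated vertex would be adjacent, at its earlier occurrence, to the footprint of its later
   one. *)
have us : uniq (map fst s).
  rewrite uniq_pairwise pairwise_map.
  apply: (sub_in_pairwise (P := mem s) _ (introT allP (fun _ => id)) ps).
  by move=> p q _ sq /=; apply: contraNneq => ->; apply: es.
case: s es ps us => [|p0 s0] // es ps us; set s := p0 :: s0 in es ps us *.
have sz : size (map fst s) == size s by rewrite size_map.
apply: (@leq_grundy_total G (size s) (Tuple sz)); apply/andP; split=> //.
have tnthE (j : 'I_(size s)) : tnth (Tuple sz) j = (nth p0 s j).1.
  by rewrite (tnth_nth p0.1) /= -(nth_map p0 p0.1 fst).
apply/forallP=> i; apply/set0Pn; exists (nth p0 s i).2.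
rewrite !inE tnthE es ?mem_nth // andbT; apply/bigcupP=> -[j ltji].
rewrite inE tnthE; apply/negP.
by move/(pairwiseP p0): ps; apply; rewrite ?inE.
Qed.

Lemma footprinted_grundy (G : sgraph) :
  exists2 s : seq (G * G), footprinted (@adj G) s & size s = grundy_total G.
Proof.
have [t /andP[_ /forallP lt]] := grundy_total_attained G.
have /fin_all_exists [f fP] i := set0Pn _ (lt i).
exists [seq (tnth t i, f i) | i <- enum 'I_(grundy_total G)]; last first.
  by rewrite size_map size_enum_ord.
rewrite /footprinted; apply/andP; split.
  by apply/allP=> _ /mapP[i _ ->] /=; have := fP i; rewrite !inE => /andP[].
rewrite pairwise_map.
have : pairwise ltn (map val (enum 'I_(grundy_total G))).
  by rewrite val_enum_ord -(sorted_pairwise ltn_trans) iota_ltn_sorted.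
rewrite pairwise_map; apply: sub_pairwise => j i /= ltji.
have := fP i; rewrite !inE => /andP[/bigcupP nf _].
by apply/negP=> a; apply: nf; exists j; rewrite ?inE.
Qed.

Lemma grundy_product_geq (G H : sgraph) :
  grundy_total G * grundy_total H <= grundy_total (direct_product G H).
Proof.
have [s /andP[es ps] <-] := footprinted_grundy G.
have [t /andP[/allP et pt] <-] := footprinted_grundy H.
pose pr (p : G * G) (q : H * H) := ((p.1, q.1), (p.2, q.2)).
rewrite -(size_allpairs pr).
apply: (@footprinted_leq_grundy (direct_product G H)); apply/andP; split.
  apply/allP=> _ /allpairsP[[p q] /= [sp tq ->]].
  by rewrite /= /direct_adj /= (allP es) ?et.
(* The product list consists of one block per entry of [s]. Between blocks the [G]-coordinates give
   nonadjacency; within a block, the [H]-coordinates do. *)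
elim: s es ps => //= p s IHs /andP[ep es] /andP[/allP pp ps].
rewrite pairwise_cat IHs // andbT; apply/andP; split.
  apply/allrelP=> _ _ /mapP[q _ ->] /allpairsP[[p' q'] /= [sp' _ ->]].
  by rewrite /direct_adj /= (negPf (pp _ sp')).
rewrite pairwise_map; apply: sub_pairwise pt => q q' /=.
by rewrite /direct_adj /= negb_and orbC => ->.
Qed.

Definition vertex_cover (V : finType) (e : rel V) (C : {set V}) : Prop :=
  forall x y, e x y -> (x \in C) || (y \in C).

Lemma grundy_product_leq_cover (G H : sgraph) (C : {set G}) :
  vertex_cover (@adj G) C ->
  grundy_total (direct_product G H) <= 2 * #|C| * grundy_total H.
Proof.
move=> coverC.
have [s /andP[/allP es ps] <-] := footprinted_grundy (direct_product G H).
(* The flag [i] selects the vertex ([true]) or its footprint ([false]). *)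
pose at_ (c : G) (i : bool) (p : (G * H) * (G * H)) :=
  (if i then p.1.1 else p.2.1) == c.
have count_at c i : count (at_ c i) s <= grundy_total H.
  rewrite -size_filter -(size_map (fun p => (p.1.2, p.2.2))).
  apply: footprinted_leq_grundy; apply/andP; split.
    apply/allP=> _ /mapP[p /[!mem_filter] /andP[_ sp] ->].
    by have /andP[] := es _ sp.
  rewrite pairwise_map.
  pose P := [pred p | at_ c i p & p \in s].
  have allP' : all P (filter (at_ c i) s).
    by apply/allP=> p; rewrite mem_filter.
  apply: (sub_in_pairwise _ allP' (pairwise_filter _ ps)).
  move=> p q /andP[/eqP cp sp] /andP[/eqP cq sq] /=.
  (* The shared coordinate [c] makes [p.1.1] adjacent to [q.2.1], so nonadjacency in the product
     must come from [H]. *)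
  rewrite /direct_adj; apply: contra => ->; rewrite andbT.
  have /andP[ep _] := es _ sp; have /andP[eq _] := es _ sq.
  clear allP' P; case: i cp cq => cp cq; first by rewrite cp -cq.
  by rewrite cq -cp.
have le_s : size s <= \sum_(c in C) (count (at_ c true) s + count (at_ c false) s).
  elim: s es {ps count_at} => //= p s IHs es.
  have {}IHs : size s <= \sum_(c in C) (count (at_ c true) s + count (at_ c false) s).
    by apply: IHs => q sq; apply: es; rewrite inE sq orbT.
  (* Split off the contribution of [p], which is at least 1: its [G]-coordinates form an edge, and
     [C] contains an end of it. *)
  under eq_bigr do rewrite addnACA.
  rewrite big_split -add1n leq_add //=.
  have /andP[ep _] := es p (mem_head _ _).
  case/orP: (coverC _ _ ep) => Cp; rewrite (bigD1 _ Cp) /= /at_ eqxx.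
    by rewrite -addnA.
  by rewrite addn1 addSn.
apply: leq_trans le_s _.
have -> : 2 * #|C| * grundy_total H = \sum_(c in C) (grundy_total H + grundy_total H).
  by rewrite sum_nat_const addnn -mul2n mulnCA mulnA.
by apply: leq_sum => c _; rewrite leq_add.
Qed.

Lemma acyclic_leaf (V : finType) (e : rel V) (x y : V) :
  symmetric e -> irreflexive e ->
  (forall c : seq V, 2 < size c -> ~ ucycle e c) -> e x y ->
  exists v u, e v u /\ forall w, e v w -> w = u.
Proof.
move=> sym irr acyc exy.
have [/existsP[v /existsP[u /andP[evu /forallP h]]] | noleaf] :=
  boolP [exists v, exists u, e v u && [forall w, e v w ==> (w == u)]].
  by exists v, u; split=> // w evw; apply/eqP; have:= h w; rewrite evw.
(* Without leaves, paths can be extended forever. *)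
suff /(_ #|V|) [a [b [p [sz _ /card_uniqP up]]]] : forall n, exists a b p,
    [/\ size p = n, path e a (b :: p) & uniq (a :: b :: p)].
  by have := max_card [in a :: b :: p]; rewrite up /= sz ltnNge leqnSn.
elim=> [|n [a [b [p [sz pth u]]]]].
  exists x, y, [::]; rewrite /= exy !inE !andbT; split=> //.
  by apply: contraTneq exy => ->; rewrite irr.
have /existsP[w] : [exists w, e a w && (w != b)].
  move: pth => /= /andP[eab _].
  apply: contraNT noleaf => /existsPn h.
  apply/existsP; exists a; apply/existsP; exists b; rewrite eab /=.
  by apply/forallP=> w; apply/implyP=> eaw; have := h w; rewrite eaw negbK.
move=> /andP[eaw wb].
have wa : w != a by apply: contraTneq eaw => ->; rewrite irr.
exists w, a, (b :: p); split; [by rewrite /= sz | by rewrite [path _ _ _]/= sym eaw |].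
rewrite cons_uniq u andbT !inE (negPf wa) (negPf wb) /=; apply/negP=> pw.
(* If [w] lay on [p], the path from [a] through [b] to [w] would close up to a cycle of length at
   least 3. *)
case/splitPr: pw pth u {sz} => p1 p2.
rewrite -cat_rcons -cat_cons cat_path => /andP[pth _].
rewrite -cat_cons cat_uniq => /andP[u _].
apply: (acyc (a :: b :: rcons p1 w)); first by rewrite /= size_rcons.
apply/andP; split=> //.
by rewrite /cycle rcons_path pth /= last_rcons sym.
Qed.

(** The relation varies over a fixed vertex type, so that edges can be deleted by shrinking [e]; the
    induction is on the number of adjacent ordered pairs. *)
Lemma acyclic_footprinted_cover (V : finType) (e : rel V) :
  symmetric e -> irreflexive e ->
  (forall c : seq V, 2 < size c -> ~ ucycle e c) ->
  exists C s, [/\ vertex_cover e C, footprinted e s & 2 * #|C| <= size s].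
Proof.
have [n] := ubnP #|[pred p : V * V | e p.1 p.2]|.
elim: n e => // n IHn e; rewrite ltnS => le_n sym irr acyc.
have [/existsP[[x y] /= exy] | /existsPn noe] :=
  boolP [exists p : V * V, e p.1 p.2]; last first.
  exists set0, [::]; split; rewrite ?cards0 //.
  by move=> x y exy; have := noe (x, y); rewrite exy.
have [v [u [evu leaf]]] := acyclic_leaf sym irr acyc exy.
pose e' := [rel a b | [&& e a b, a != u & b != u]].
have e'e : subrel e' e by move=> a b /and3P[].
have [|a b|a||C [s [coverC /andP[/allP es ps] le_s]]] := IHn e'.
- apply: leq_trans le_n; apply: proper_card; apply/properP; split.
    by apply/subsetP=> p; apply: e'e.
  by exists (v, u); rewrite !inE //= eqxx !andbF.
- by rewrite /= sym [(a != u) && _]andbC.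
- by rewrite /= irr.
- by move=> c szc /andP[cc uc]; apply: (acyc c szc); rewrite /ucycle (sub_cycle e'e cc).
have vu : v != u by apply: contraTneq evu => ->; rewrite irr.
exists (u |: C), ((v, u) :: rcons s (u, v)); split.
- move=> a b eab; rewrite !inE.
  have [//|au] := eqVneq a u; have [|bu] := eqVneq b u; first by rewrite orbT.
  by rewrite /= coverC //= eab au.
- apply/andP; split.
    rewrite /= evu all_rcons /= sym evu /=.
    by apply/allP=> p /es /e'e.
  rewrite pairwise_cons pairwise_rcons !all_rcons /= irr /=.
  (* The pairs of [s] avoid [u], the only neighbor of [v]: hence [v] is adjacent to no footprint in
     [s], no vertex in [s] is adjacent to [v], and [e'] agrees with [e] between entries of [s]. *)
  apply/and3P; split.
  + apply/allP=> p /es /= /and3P[_ _ pu].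
    by apply: contra pu => /leaf ->.
  + apply/allP=> p /es /= /and3P[_ pu _].
    by rewrite sym; apply: contra pu => /leaf ->.
  + apply: (sub_in_pairwise (P := mem s) _ (introT allP (fun _ => id)) ps).
    move=> p q /es /= /and3P[_ pu _] /es /= /and3P[_ _ qu].
    by rewrite pu qu !andbT.
- rewrite /= size_rcons (leq_trans (n := 2 * #|C|.+1)) //.
    by rewrite leq_mul2l /= cardsU1 -add1n leq_add2r leq_b1.
  by rewrite mulnS add2n !ltnS.
Qed.

Theorem corollary2p8 (T H : sgraph) (hT : is_tree T) :
  grundy_total (direct_product T H) = grundy_total T * grundy_total H.
Proof.
have [_ acyc] := hT.
have [C [s [coverC fs le_s]]] :=
  acyclic_footprinted_cover (@adj_sym T) (@adj_irr T) acyc.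
apply/eqP; rewrite eqn_leq grundy_product_geq andbT.
apply: leq_trans (grundy_product_leq_cover H coverC) _.
by rewrite leq_mul2r (leq_trans le_s (footprinted_leq_grundy fs)) orbT.
Qed.
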